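(* (i) Let $q,n,s$ be nonnegative integers with $q \ge 3$, $n \ge 1$, $0 \le s \le n-1$ and $s$ even. Then the minimum of $\kappa^*(A_{q,n,s-2b,b})$ over integers $0 \le b \le s/2$ is attained at \[ b = \begin{cases} s/2 & \text{if } s \le \frac{2}{q}(n-1),\\ \left\lfloor \frac{n-1-s}{q-2}\right\rfloor & \text{if } s \ge \frac{2}{q}(n-1).\end{cases} \] (ii) Let $q \ge 3$ and $\delta$ with $\frac{2}{q} \le \delta \le 1$ be fixed, and for each $n$ let $s = s_n$ be an even integer with $0 \le s_n \le n$ and $s_n / n \to \delta$. Then \[ \lim_{n\to\infty} \frac{1}{n}\log \min_{0 \le b \le s_n/2} \kappa^*(A_{q,n,s_n-2b,b}) = (1-\delta)\log(q-1). \]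
   Context: For integers $q \ge 2$, $n \ge 1$, $0 \le a \le n$, $b \ge 0$, the channel $A_{q,n,a,b}$ has input set $[q]^n$ ($[q]=\{0,\dots,q-1\}$) and output set the strings $y \in ([q]\cup\{*\})^n$ with exactly $a$ positions equal to the erasure symbol $*$; $(A_{q,n,a,b})_{x,y}=1$ iff $|\{i : y_i\ne *,\ y_i \ne x_i\}| \le b$ ($a$ erasures and at most $b$ substitutions). For $A \in \{0,1\}^{X\times Y}$, $\kappa^*(A) = \min\{\mathbf{1}^T z : z \in \mathbb{R}^Y,\ z\ge\mathbf{0},\ Az \ge\mathbf{1}\}$. The logarithm is to any fixed base (the same on both sides). *)

(* Defs.v *)
From HB Require Import structures.
From mathcomp Require Import all_boot all_order all_algebra.
From mathcomp Require Import all_classical all_reals all_analysis.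
Set Implicit Arguments. Unset Strict Implicit. Unset Printing Implicit Defensive.
Import Order.TTheory GRing.Theory Num.Theory.
Local Open Scope classical_set_scope.
Local Open Scope ring_scope.

(* Fractional covering number kappa^*(A) of a 0/1 matrix A indexed by X x Y:
   min { 1^T z : z in R^Y, z >= 0, A z >= 1 }  (the LP optimum; the infimum
   of the feasible objective values, which is attained). *)
Definition kappa_star (R : realType) (X Y : finType) (A : X -> Y -> bool) : R :=
  inf [set v : R | exists z : Y -> R,
        (forall y, 0 <= z y) /\
        (forall x, 1 <= \sum_(y | A x y) z y) /\
        v = \sum_y z y].

Definition chan_in (q n : nat) := {ffun 'I_n -> 'I_q}.
(* Outputs: strings over [q] ∪ {*} (None = the erasure symbol) with exactly a erasures. *)
Definition chan_out (q n a : nat) :=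
  {y : {ffun 'I_n -> option 'I_q} | #|[set i | y i == None]| == a}.

Definition chanA (q n a b : nat) (x : chan_in q n) (y : chan_out q n a) : bool :=
  (#|[set i | (val y i != None) && (val y i != Some (x i))]| <= b)%N.

Definition kappaA (R : realType) (q n a b : nat) : R :=
  kappa_star R (@chanA q n a b).

(* Main.v *)
Require Import Defs.
From HB Require Import structures.
From mathcomp Require Import all_boot all_order all_algebra.
From mathcomp Require Import perm.
From mathcomp Require Import all_classical all_reals all_analysis.
From mathcomp Require Import zify lra.
Import Order.TTheory GRing.Theory Num.Theory.
Import numFieldNormedType.Exports.
Set Implicit Arguments. Unset Strict Implicit. Unset Printing Implicit Defensive.

(* Each channel matrix is biregular, so double counting gives
   kappa^*(A_{q,n,a,b}) = q^m / V(m,b), where m = n - a and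
   V(m,b) = sum_{i <= b} C(m,i) (q-1)^i is the size of a Hamming ball.  With
   t = n - s this leaves the numbers q^(t+2b) / V(t+2b,b) to be minimised over b.
   Comparing words of length m + 2 with words of length m,
   V(m+2,b+1) - q^2 V(m,b) = C(m,b+1) (q-1)^(b+1) - C(m,b) (q-1)^(b+2),
   so passing from b to b + 1 does not increase the ratio iff (q-2)(b+1) < t;
   this gives (i).
   For (ii), expanding q^m = ((q-1) + 1)^m shows that the ratio is at least
   (q-1)^t for every b.  Conversely, for m = qb the largest term of that expansion
   is C(m,b) (q-1)^(m-b), so that q^m is at most m + 1 times it; monotonicity of V
   in m then bounds the ratio by q^(t-(q-2)b) (qb+1) (q-1)^t whenever
   (q-2)b <= t.  Choosing b = min(floor(t/(q-2)), s/2) makes the exponent of q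
   sublinear in n, and the limit follows. *)

(** * Sizes of Hamming balls *)

Definition ball_size (q m b : nat) : nat :=
  \sum_(i < b.+1) 'C(m, i) * q.-1 ^ i.

Lemma ball_size_gt0 q m b : 0 < ball_size q m b.
Proof. by rewrite /ball_size big_ord_recl bin0. Qed.

Lemma ball_sizeS q m b :
  ball_size q m.+1 b.+1 = ball_size q m b.+1 + q.-1 * ball_size q m b.
Proof.
rewrite /ball_size big_ord_recl [in RHS]big_ord_recl !bin0 -addnA.
congr (_ + _); rewrite big_distrr /= -big_split /=.
by apply: eq_bigr => i _; rewrite /bump !add1n binS expnS; lia.
Qed.

Lemma ball_size_mono q m m' b : m <= m' ->
  ball_size q m b <= ball_size q m' b.
Proof.
by move=> mm'; apply: leq_sum => i _; rewrite leq_mul2r leq_bin2l ?orbT.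
Qed.

Lemma ball_size_recr q m b :
  ball_size q m b.+1 = ball_size q m b + 'C(m, b.+1) * q.-1 ^ b.+1.
Proof. by rewrite /ball_size big_ord_recr. Qed.

(** Two uses of Pascal's rule leave balls of radius b + 1, b and b - 1 in length m, which differ by
    single terms. The negative term is moved to the left to avoid truncated subtraction. *)
Lemma ball_size_step q m b : 0 < q ->
  ball_size q m.+2 b.+1 + 'C(m, b) * q.-1 ^ b.+2 =
  q ^ 2 * ball_size q m b + 'C(m, b.+1) * q.-1 ^ b.+1.
Proof.
case: q => // p _; rewrite !ball_sizeS // ball_size_recr.
case: b => [|b]; last rewrite !ball_sizeS // !ball_size_recr /= !expnS; last first.
  by nia.
rewrite /ball_size !big_ord_recl !big_ord0 !bin0 !bin1 /= !expnS !expn0; nia.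
Qed.

Lemma leq_ball_size_step q t b : 1 < q ->
  (q ^ 2 * ball_size q (t + b.*2) b <= ball_size q (t + b.+1.*2) b.+1)
  = (q.-1 * b.+1 <= t + b).
Proof.
move=> q1; have := ball_size_step (t + b.*2) b (ltnW q1).
rewrite -!addnS -doubleS => step.
have Cgt0 : 0 < 'C(t + b.*2, b) by rewrite bin_gt0; lia.
have q1gt0 : 0 < q.-1 ^ b.+1 by rewrite expn_gt0; lia.
(* Only the two correction terms of [step] matter, and they share the factor [q.-1 ^ b.+1]. The
   ratio of the two binomials is then (t + b) / (b + 1). *)
transitivity (q.-1 * 'C(t + b.*2, b) <= 'C(t + b.*2, b.+1)).
  rewrite -[RHS](leq_pmul2r q1gt0); move: step; rewrite [_ ^ b.+2]expnS.
  by rewrite mulnCA mulnA; lia.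
rewrite -(leq_pmul2l (ltn0Sn b)) mul_bin_left -[RHS](leq_pmul2r Cgt0).
have -> : t + b.*2 - b = t + b by lia.
by rewrite mulnA [b.+1 * _]mulnC.
Qed.

(** With m = t + 2b and i <= b, one has t + i <= m - i, so each summand on the left is at most the
    term of index i in the expansion of ((q-1) + 1)^m. *)
Lemma ball_size_chernoff q t b : 1 < q ->
  ball_size q (t + b.*2) b * q.-1 ^ t <= q ^ (t + b.*2).
Proof.
move=> q1; have {3}-> : q = q.-1 + 1 by lia.
rewrite expnDn /ball_size big_distrl /=.
rewrite [leqRHS](bigID (fun i : 'I_(t + b.*2).+1 => i < b.+1)) /=.
apply: leq_trans (leq_addr _ _).
have le : b.+1 <= (t + b.*2).+1 by lia.
rewrite (big_ord_widen_cond _ xpredT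
  (fun i => 'C(t + b.*2, i) * q.-1 ^ i * q.-1 ^ t) le) /=.
apply: leq_sum => i ib; rewrite exp1n muln1 -mulnA leq_mul2l -expnD.
by rewrite leq_pexp2l ?orbT //; lia.
Qed.

(** Up to scaling, the terms of the expansion form a binomial law with qb trials and success
    probability 1/q, whose mode is its mean b. *)
Lemma ball_size_mode q b : 0 < q ->
  q ^ (q * b) <= (q * b).+1 * ('C(q * b, b) * q.-1 ^ (q * b - b)).
Proof.
move=> q0; have {1}-> : q = q.-1 + 1 by lia.
rewrite expnDn; set m := q * b.
pose T i := 'C(m, i) * q.-1 ^ (m - i).
have bm : b <= m by rewrite leq_pmull.
have mb : m - b = q.-1 * b by rewrite /m; nia.
have Trec i : i < m -> i.+1 * q.-1 * T i.+1 = (m - i) * T i.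
  move=> im; rewrite /T mulnA mulnA -mul_bin_left -(subnSK im) expnS; lia.
have Tup i : i < b -> T i <= T i.+1.
  move=> ib; have im : i < m by lia.
  rewrite -(@leq_pmul2l (m - i)) ?subn_gt0 // -Trec // leq_mul2r.
  by apply/orP; right; nia.
have Tdn i : b <= i -> i < m -> T i.+1 <= T i.
  (* For q = 1 one has m = b, which leaves no index i in this range. *)
  move=> bi im; have p0 : 0 < q.-1 by rewrite lt0n; apply/eqP => p0; nia.
  rewrite -(@leq_pmul2l (i.+1 * q.-1)) ?muln_gt0 ?p0 // Trec // leq_mul2r.
  by apply/orP; right; nia.
have Tmax i : i <= m -> T i <= T b.
  move=> im; case: (leqP i b) => ib.
    (* Induction on the distance d below b; once d reaches b, the truncated [b - d] stays at 0. *)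
    rewrite -(subKn ib); elim: (b - i) => [|d IH]; first by rewrite subn0.
    apply: leq_trans IH; have [bd|db] := leqP b d.
      by rewrite (_ : b - d.+1 = b - d) //; lia.
    by rewrite -(subnSK db); apply: Tup; lia.
  rewrite -(subnKC (ltnW ib)).
  have : b + (i - b) <= m by lia.
  elim: (i - b) => [|k IH] kb; first by rewrite addn0.
  rewrite addnS; apply: leq_trans (IH _); last by lia.
  by apply: Tdn; lia.
rewrite -[leqRHS]/(m.+1 * T b) -[in leqRHS](card_ord m.+1) -sum_nat_const.
apply: leq_sum => i _; rewrite exp1n muln1; apply: Tmax.
by rewrite -ltnS.
Qed.

(** The channel definitions count positions through classical sets; this passes to boolean
    predicates. *)
Lemma card_mkset (T : finType) (P : pred T) : #|mkset P| = #|P|.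
Proof. by apply: eq_card => x; rewrite unfold_in /= asboolb. Qed.

Lemma sum_subset_card_le (T : finType) (M : {set T}) (b : nat) (F : nat -> nat) :
  \sum_(E : {set T} | (E \subset M) && (#|E| <= b)) F #|E| =
  \sum_(k < b.+1) 'C(#|M|, k) * F k.
Proof.
rewrite (partition_big (fun E : {set T} => inord #|E| : 'I_b.+1) xpredT) //=.
apply: eq_bigr => k _; rewrite -cards_draws -sum_nat_const.
apply: congr_big => // [E | E /andP[/andP[_ Eb] /eqP <-]].
  rewrite inE -andbA; congr (_ && _).
  apply/andP/eqP => [[Eb /eqP<-] | Ek]; first by rewrite inordK.
  have Eb : #|E| <= b by rewrite Ek -ltnS.
  by split => //; apply/eqP/val_inj; rewrite /= inordK.
by rewrite inordK.
Qed.

(** * Inputs compatible with a given output *)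

Section Counting.
Variables (I : finType) (q b : nat).
Implicit Types (x : {ffun I -> 'I_q}) (y : {ffun I -> option 'I_q}).

Let nonerased y := [set i | y i != None]%SET.
Let errors y x := [set i | (y i != None) && (y i != Some (x i))]%SET.

(** Coordinates are independent: q - 1 letters are possible on E, one on the other unerased
    positions, q on the erased ones. *)
Lemma card_errors_eq y (E : {set I}) : E \subset nonerased y ->
  #|[pred x | errors y x == E]| = q.-1 ^ #|E| * q ^ #|[pred i | y i == None]|.
Proof.
move=> /fintype.subsetP EM.
pose F i : pred 'I_q := fun a => if i \in E then y i != Some a
                   else (y i == None) || (y i == Some a).
have -> : #|[pred x | errors y x == E]| = #|family F|.
  apply: eq_card => x; rewrite !inE; apply/eqP/familyP => [eE i|Fx].
    by rewrite unfold_in /F -eE !inE; case: (y i) => //= c; case: ifP => // /negbFE.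
  apply/finset.setP => i; have := Fx i; rewrite unfold_in /F !inE.
  case: ifP => [iE -> | _]; last by case: (y i) => //= c ->.
  by have := EM _ iE; rewrite inE => ->.
rewrite card_family foldrE big_image /=.
transitivity (\prod_i ((if i \in E then q.-1 else 1) *
                       (if i \in [pred i | y i == None] then q else 1))).
  apply: eq_bigr => i _; rewrite inE /F; case: ifP => iE.
    have := EM _ iE; rewrite inE; case: (y i) => //= c _.
    rewrite muln1 -[in RHS](card_ord q) -(cardC1 c).
    by apply: eq_card => a; rewrite !inE unfold_in /= eq_sym.
  case: (y i) => /= [c|]; last first.
    by rewrite mul1n -[in RHS](card_ord q); apply: eq_card => a; rewrite inE.
  rewrite muln1 -(card1 c); apply: eq_card => a.
  by rewrite !inE unfold_in /= eq_sym.
by rewrite big_split /= -!big_mkcond /= !prod_nat_const.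
Qed.

Lemma card_hamming_ball y :
  #|[pred x : {ffun I -> 'I_q} |
      #|[pred i | (y i != None) && (y i != Some (x i))]| <= b]| =
  q ^ #|[pred i | y i == None]| * ball_size q #|[pred i | y i != None]| b.
Proof.
rewrite -sum1_card.
rewrite (partition_big (errors y)
  (fun E : {set I} => (E \subset nonerased y) && (#|E| <= b))) /=; last first.
  move=> x; rewrite !inE cardsE => ->; rewrite andbT.
  by apply/fintype.subsetP => i; rewrite !inE => /andP[].
rewrite mulnC /ball_size big_distrl /=.
rewrite -[in RHS]cardsE.
under [RHS]eq_bigr do rewrite -mulnA.
rewrite -(sum_subset_card_le _ _
  (fun k => q.-1 ^ k * q ^ #|[pred i | y i == None]|)).
apply: eq_bigr => E /andP[EM Eb]; rewrite -card_errors_eq // -sum1_card.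
apply: eq_bigl => x; rewrite !inE andb_idl // => /eqP ex.
by move: Eb; rewrite -ex /errors cardsE.
Qed.

End Counting.

Lemma double_count (X Y : finType) (A : X -> Y -> bool) (r c : nat) :
  (forall x, #|[pred y | A x y]| = r) -> (forall y, #|[pred x | A x y]| = c) ->
  #|X| * r = #|Y| * c.
Proof.
move=> Ar Ac; rewrite -!sum_nat_const.
transitivity (\sum_x \sum_(y | A x y) 1).
  by apply: eq_bigr => x _; rewrite sum1_card Ar.
rewrite (exchange_big_dep xpredT) //=.
by apply: eq_bigr => y _; rewrite sum1_card Ac.
Qed.

(** * Row and column degrees of the channel *)

Section Channel.
Variables (q n a b : nat).

(** Swapping the letters [x i] and [x' i] at each position fixes the erasures and turns errors
    against x into errors against x'. Row degrees are thus compared by symmetry and never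
    computed. *)
Definition relabel (x x' : chan_in q n) (y : {ffun 'I_n -> option 'I_q}) :
    {ffun 'I_n -> option 'I_q} :=
  [ffun i => omap (tperm (x i) (x' i)) (y i)].

Lemma relabelK x x' : cancel (relabel x x') (relabel x x').
Proof.
by move=> y; apply/ffunP => i; rewrite !ffunE; case: (y i) => //= c; rewrite tpermK.
Qed.

Lemma erasures_relabel x x' (y : chan_out q n a) :
  #|[set i | relabel x x' (val y) i == None]%classic| == a.
Proof.
rewrite -[X in _ == X](eqP (valP y)); apply/eqP; rewrite !card_mkset.
by apply: eq_card => i; rewrite !unfold_in ffunE; case: (val y i).
Qed.

Definition chan_relabel x x' (y : chan_out q n a) : chan_out q n a :=
  exist _ (relabel x x' (val y)) (erasures_relabel x x' y).

Lemma chan_relabel_inj x x' : injective (chan_relabel x x').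
Proof.
move=> y y' /(congr1 val) /= /(congr1 (relabel x x')).
by rewrite !relabelK => /val_inj.
Qed.

Lemma chanA_relabel x x' y : chanA b x' (chan_relabel x x' y) = chanA b x y.
Proof.
rewrite /chanA !card_mkset; congr (_ <= b); apply: eq_card => i.
rewrite !unfold_in /= ffunE; case: (val y i) => //= c.
by rewrite -{2}(tpermL (x i) (x' i)) (inj_eq Some_inj) (inj_eq perm_inj).
Qed.

Lemma card_chanA_row (x x' : chan_in q n) :
  #|[pred y | chanA (a := a) b x y]| = #|[pred y | chanA (a := a) b x' y]|.
Proof.
wlog suff: x x' / #|[pred y | chanA (a := a) b x y]| <=
    #|[pred y | chanA (a := a) b x' y]|.
  by move=> le; apply/eqP; rewrite eqn_leq !le.
rewrite -(fintype.card_image (@chan_relabel_inj x x')); apply: subset_leq_card.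
apply/fintype.subsetP => y /fintype.imageP[y']; rewrite !inE => Ay' ->.
by rewrite chanA_relabel.
Qed.

Lemma card_chanA_col (y : chan_out q n a) :
  #|[pred x | chanA b x y]| = q ^ a * ball_size q (n - a) b.
Proof.
have Ey : #|[pred i | val y i == None]| = a.
  by have /eqP := valP y; rewrite card_mkset.
have NEy : #|[pred i | val y i != None]| = n - a.
  have := cardC [pred i | val y i == None]; rewrite Ey card_ord.
  rewrite (eq_card (B := [pred i | val y i != None])) //; lia.
rewrite -NEy -[X in q ^ X]Ey -card_hamming_ball.
by apply: eq_card => x; rewrite !inE /chanA card_mkset.
Qed.

Lemma card_chan_out_gt0 : 0 < q -> a <= n -> 0 < #|{: chan_out q n a}|.
Proof.
move=> q_gt0 an.
pose y := [ffun i : 'I_n => if (i < a) then None else Some (Ordinal q_gt0)].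
have ya : #|[set i | y i == None]%classic| == a.
  rewrite card_mkset -sum1_card.
  rewrite -[X in _ == X](card_ord a) -[X in _ == X]sum1_card.
  rewrite (big_ord_widen _ (fun=> 1) an); apply/eqP/eq_bigl => i.
  by rewrite unfold_in ffunE; case: ifP.
by apply/card_gt0P; exists (exist _ y ya).
Qed.

End Channel.

Local Open Scope classical_set_scope.
Local Open Scope ring_scope.

(** * The exact value of the covering number *)

Lemma kappa_star_biregular (R : realType) (X Y : finType) (A : X -> Y -> bool)
    (r c : nat) :
  (0 < r)%N -> (0 < c)%N ->
  (forall x, #|[pred y | A x y]| = r) -> (forall y, #|[pred x | A x y]| = c) ->
  kappa_star R A = #|X|%:R / c%:R.
Proof.
move=> r0 c0 Ar Ac; rewrite /kappa_star.
set S := (X in inf X); set v := (RHS).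
have r0' : r%:R != 0 :> R by rewrite pnatr_eq0 -lt0n.
have c0' : c%:R != 0 :> R by rewrite pnatr_eq0 -lt0n.
(* The uniform weight 1/r is feasible, and double counting turns its value |Y|/r into |X|/c. *)
have Sv : S v.
  exists (fun=> r%:R^-1); split; first by move=> _; rewrite invr_ge0.
  split=> [x|]; first by rewrite sumr_const Ar -[leRHS]mulr_natr mulVf.
  rewrite sumr_const /v -[RHS]mulr_natr; apply: (mulIf c0'); apply: (mulfI r0').
  by rewrite divfK // -mulrA mulVKf // -!natrM -(double_count Ar Ac) mulnC.
(* Summing all covering constraints counts each [z y] exactly c times. *)
have lbv : lbound S v.
  move=> _ [z [z0 [Az ->]]]; rewrite /v ler_pdivrMr ?ltr0n //.
  apply: (@le_trans _ _ (\sum_x \sum_(y | A x y) z y)).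
    by rewrite -sumr_const; apply: ler_sum => x _; exact: Az.
  rewrite (exchange_big_dep xpredT) //= mulr_suml; apply: ler_sum => y _.
  by rewrite sumr_const Ac mulr_natr.
apply/le_anti/andP; split; first by apply: ge_inf => //; exists v.
by apply: lb_le_inf => //; exists v.
Qed.

Lemma kappaAE (R : realType) (q n a b : nat) : (0 < q)%N -> (a <= n)%N ->
  kappaA R q n a b = q%:R ^+ (n - a) / (ball_size q (n - a) b)%:R.
Proof.
move=> q0 an; pose x0 : chan_in q n := [ffun => Ordinal q0].
pose r := #|[pred y | chanA (a := a) b x0 y]|.
have Ar (x : chan_in q n) : #|[pred y | chanA (a := a) b x y]| = r.
  exact: card_chanA_row.
have Ac := @card_chanA_col q n a b.
have c0 : (0 < q ^ a * ball_size q (n - a) b)%N.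
  by rewrite muln_gt0 expn_gt0 q0 ball_size_gt0.
(* Double counting transfers positivity from the columns to the rows. *)
have r0 : (0 < r)%N.
  have : (0 < #|{: chan_in q n}| * r)%N.
    by rewrite (double_count Ar Ac) muln_gt0 c0 card_chan_out_gt0.
  by rewrite muln_gt0 => /andP[].
rewrite /kappaA (kappa_star_biregular R r0 c0 Ar Ac) card_ffun !card_ord.
rewrite -{1}(subnKC an) expnD !natrM !natrX -mulf_div divff ?mul1r //.
by rewrite expf_neq0 // pnatr_eq0 -lt0n.
Qed.

(** * The ratio as a function of b *)

Section CoverRatio.
Variables (R : realType) (q : nat).
Hypothesis q_ge3 : (3 <= q)%N.

Definition cover_ratio (t b : nat) : R :=
  q%:R ^+ (t + b.*2) / (ball_size q (t + b.*2) b)%:R.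

Lemma kappaA_cover_ratio n s b : (s <= n)%N -> (b <= s./2)%N ->
  kappaA R q n (s - 2 * b) b = cover_ratio (n - s) b.
Proof.
move=> sn bs; rewrite kappaAE /cover_ratio; [|lia|lia].
by have -> : (n - (s - 2 * b) = n - s + b.*2)%N by lia.
Qed.

Lemma cover_ratio_step t b :
  (cover_ratio t b.+1 <= cover_ratio t b) = (q.-1 * b.+1 <= t + b)%N.
Proof.
rewrite -leq_ball_size_step; last by lia.
rewrite /cover_ratio ler_pdivrMr ?ltr0n ?ball_size_gt0 // mulrAC.
rewrite ler_pdivlMr ?ltr0n ?ball_size_gt0 // doubleS !addnS -addn2 exprD -mulrA.
have q_gt0 : 0 < q%:R :> R by rewrite ltr0n; lia.
rewrite ler_pM2l ?exprn_gt0 //.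
by rewrite -natrX -natrM ler_nat.
Qed.

(** The step from k to k + 1 does not increase the ratio iff (q-2)(k+1) < t, and this is most
    restrictive at k + 1 = b'. *)
Lemma cover_ratio_nonincreasing t b b' : ((q - 2) * b' < t)%N -> (b <= b')%N ->
  cover_ratio t b' <= cover_ratio t b.
Proof.
move=> b't bb'; rewrite -(subnKC bb'); have : (b + (b' - b) <= b')%N by lia.
elim: (b' - b)%N => [|k IH] kb; first by rewrite addn0.
rewrite addnS; apply: le_trans (IH _); last by lia.
by rewrite cover_ratio_step; nia.
Qed.

Lemma cover_ratio_nondecreasing t b b' : (t <= (q - 2) * b.+1)%N -> (b <= b')%N ->
  cover_ratio t b <= cover_ratio t b'.
Proof.
move=> tb bb'; rewrite -(subnKC bb').
elim: (b' - b)%N => [|k IH]; first by rewrite addn0.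
rewrite addnS; apply: (le_trans IH); rewrite ltW // ltNge cover_ratio_step.
by apply/negP; nia.
Qed.

Lemma cover_ratio_ge t b : q.-1%:R ^+ t <= cover_ratio t b.
Proof.
rewrite /cover_ratio ler_pdivlMr ?ltr0n ?ball_size_gt0 // mulrC.
rewrite -!natrX -natrM ler_nat; apply: ball_size_chernoff; lia.
Qed.

(** Split t + 2b as d + qb. The mode C(qb,b) (q-1)^(qb-b) is the last term of V(qb,b) times
    (q-1)^((q-2)b), and V(qb,b) <= V(d+qb,b). *)
Lemma cover_ratio_le t b : ((q - 2) * b <= t)%N ->
  cover_ratio t b <=
    q%:R ^+ (t - (q - 2) * b) * (q * b).+1%:R * q.-1%:R ^+ t.
Proof.
move=> bt; rewrite /cover_ratio ler_pdivrMr ?ltr0n ?ball_size_gt0 //.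
rewrite -!natrX -!natrM ler_nat.
have -> : (t + b.*2 = t - (q - 2) * b + q * b)%N by nia.
set d := (t - _)%N; rewrite expnD -!mulnA leq_mul2l; apply/orP; right.
have q0 : (0 < q)%N by lia.
apply: leq_trans (ball_size_mode b q0) _.
rewrite leq_mul2l; apply/orP; right.
have -> : (q * b - b = (q - 2) * b + b)%N by nia.
rewrite expnD mulnCA; apply: leq_mul; first by rewrite leq_pexp2l //; lia.
apply: leq_trans (ball_size_mono q b (leq_addl d _)).
by rewrite /ball_size big_ord_recr leq_addl.
Qed.

End CoverRatio.

(** For even s, qs <= 2(n-1) says (q-2)(s/2) < n - s, so the ratio never increases up to s/2.
    Otherwise [b0] is the last b with (q-2)b < n - s, where the ratio turns. *)
Lemma kappaA_argmin (R : realType) (q n s : nat) :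
  (3 <= q)%N -> (1 <= n)%N -> (s <= n - 1)%N -> ~~ odd s ->
     ((q * s <= 2 * (n - 1))%N ->
        forall b : nat, (b <= s./2)%N ->
          kappaA R q n (s - 2 * s./2) s./2 <= kappaA R q n (s - 2 * b) b) /\
     ((2 * (n - 1) <= q * s)%N ->
        let b0 := ((n - 1 - s) %/ (q - 2))%N in
        forall b : nat, (b <= s./2)%N ->
          kappaA R q n (s - 2 * b0) b0 <= kappaA R q n (s - 2 * b) b).
Proof.
move=> q3 n1 sn1 s_even; have sn : (s <= n)%N by lia.
have s2 : s = (2 * s./2)%N by lia.
split=> qs => [|b0] b bs; rewrite !kappaA_cover_ratio //.
- by apply: cover_ratio_nonincreasing => //; nia.
- have b0t : ((q - 2) * b0 <= n - 1 - s)%N by rewrite mulnC leq_divM.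
  have tb0 : (n - s <= (q - 2) * b0.+1)%N.
    have : (n - 1 - s < (q - 2) * b0.+1)%N by rewrite mulnC ltn_ceil //; lia.
    lia.
  have [bb0|b0b] := leqP b b0.
    by apply: cover_ratio_nonincreasing => //; lia.
  by apply: cover_ratio_nondecreasing => //; apply: ltnW.
(* Admissibility of [b0]: n - 1 - s <= (q-2)(s/2), hence b0 <= s/2. *)
- have : ((q - 2) * b0 <= n - 1 - s)%N by rewrite mulnC leq_divM.
  clearbody b0; nia.
Qed.

(** * The exponential growth rate of the minimum *)

Definition min_kappaA (R : realType) (q n s : nat) : R :=
  \big[Order.min/kappaA R q n s 0]_(b < s./2.+1) kappaA R q n (s - 2 * b) b.

Lemma min_kappaA_ge (R : realType) (q n s : nat) : (3 <= q)%N -> (s <= n)%N ->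
  q.-1%:R ^+ (n - s) <= min_kappaA R q n s.
Proof.
move=> q3 sn; have ge b : (b <= s./2)%N ->
    q.-1%:R ^+ (n - s) <= kappaA R q n (s - 2 * b) b.
  by move=> bs; rewrite kappaA_cover_ratio // cover_ratio_ge.
(* The default value of the minimum is its entry at b = 0. *)
apply: le_bigmin; first by rewrite -[X in kappaA R q n X]subn0; exact: (ge 0).
by move=> b _; apply: ge; rewrite -ltnS.
Qed.

Lemma min_kappaA_le (R : realType) (q n s : nat) : (3 <= q)%N -> (s <= n)%N ->
  exists2 d, (d <= q + (n - q * s./2))%N &
  min_kappaA R q n s <= q%:R ^+ d * n.+1%:R * q.-1%:R ^+ (n - s).
Proof.
move=> q3 sn; pose b := minn ((n - s) %/ (q - 2)) s./2.
have bt : ((q - 2) * b <= n - s)%N.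
  rewrite (leq_trans _ (leq_divM (n - s) (q - 2))) // mulnC.
  by rewrite leq_mul2r geq_minl orbT.
have bs : (b <= s./2)%N by rewrite geq_minr.
exists (n - s - (q - 2) * b)%N.
  (* If the quotient is the smaller, d is a remainder modulo q - 2; if s/2 is, then d <= n -
     q(s/2). *)
  rewrite /b /minn; case: ltnP => _; last by nia.
  have : (n - s < ((n - s) %/ (q - 2)).+1 * (q - 2))%N by rewrite ltn_ceil //; lia.
  nia.
apply: (bigmin_inf (inord b : 'I_s./2.+1)) => //; rewrite inordK //.
rewrite kappaA_cover_ratio //; apply: le_trans (cover_ratio_le _ _ bt) _ => //.
rewrite ler_wpM2r ?exprn_ge0 // ler_wpM2l ?exprn_ge0 // ler_nat.
(* Here qb = (q-2)b + 2b <= (n - s) + s. *)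
nia.
Qed.

(** With r^2 = n + 1, ln(n+1) = 2 ln r <= 2r, while n >= r^2 / 2. *)
Lemma lnS_over_n_le (R : realType) (n : nat) : (0 < n)%N ->
  ln n.+1%:R / n%:R <= 4 * Num.sqrt (harmonic n) :> R.
Proof.
move=> n0; set r : R := Num.sqrt n.+1%:R.
have r0 : 0 < r by rewrite sqrtr_gt0 ltr0n.
have r2 : n.+1%:R = r * r by rewrite -expr2 sqr_sqrtr.
have -> : Num.sqrt (harmonic n) = r^-1 :> R by rewrite /harmonic/= sqrtrV.
have lr : ln r <= r by exact/ltW/ln_sublinear.
rewrite ler_pdivrMr ?ltr0n // r2 lnM ?posrE //.
have nr : r * r <= 2 * n%:R by rewrite -r2 -natrM ler_nat; lia.
have : r <= 2 * n%:R / r by rewrite ler_pdivlMr.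
lra.
Qed.

Lemma cvg_ln_min_kappaA (R : realType) (q : nat) (delta : R) (s : nat -> nat) :
  (3 <= q)%N -> 2 / q%:R <= delta ->
  (forall n, ~~ odd (s n) /\ (s n <= n)%N) ->
  (fun n : nat => (s n)%:R / n%:R : R) @ \oo --> delta ->
  (fun n : nat => ln (min_kappaA R q n (s n)) / n%:R : R) @ \oo -->
    (1 - delta) * ln (q%:R - 1).
Proof.
move=> q3 qd s_even sd; set L := ln (q%:R - 1).
have q0 : 0 < q%:R :> R by rewrite ltr0n; lia.
have qE : q.-1%:R = q%:R - 1 :> R by rewrite -subn1 natrB //; lia.
have p0 : 0 < q.-1%:R :> R by rewrite ltr0n; lia.
pose u n : R := (s n)%:R / n%:R.
(* z n = (n - q s / 2) / n has a limit <= 0, and (z + |z|) / 2 is its positive part. *)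
pose z n : R := 1 - q%:R / 2 * u n.
pose f n : R := (1 - u n) * L.
(* [f] is the rate of the lower bound (q-1)^(n-s). The terms added in [h] dominate ln(n+1)/n and
   (d/n) ln q, with d from [min_kappaA_le] and 1/n <= 2/(n+1). *)
pose h n : R := f n + (4 * Num.sqrt (harmonic n) +
  (q%:R * (2 * harmonic n) + (z n + `|z n|) / 2) * ln q%:R).
apply: (@squeeze_cvgr _ _ _ _ f h).
- near=> n; have n0 : (0 < n)%N by near: n; exact: nbhs_infty_gt.
  have n0' : 0 < n%:R :> R by rewrite ltr0n.
  have [sn_even sn] := s_even n.
  have tE : (n - s n)%:R / n%:R = 1 - u n :> R.
    by rewrite natrB // mulrBl divff ?gt_eqF.
  have lb := min_kappaA_ge R q3 sn.
  have M0 : 0 < min_kappaA R q n (s n) by apply: lt_le_trans lb; rewrite exprn_gt0.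
  apply/andP; split.
    rewrite /f -tE mulrAC ler_pM2r ?invr_gt0 // /L -qE mulr_natl -lnXn //.
    by rewrite ler_ln ?posrE ?exprn_gt0.
  have [d dle ub] := min_kappaA_le R q3 sn.
  have -> : h n = f n + (h n - f n) by rewrite addrC subrK.
  have : ln (min_kappaA R q n (s n)) / n%:R <=
     (ln q%:R *+ d + ln n.+1%:R + L *+ (n - s n)) / n%:R.
    rewrite ler_pM2r ?invr_gt0 // /L -qE -!lnXn // -!lnM;
      rewrite ?posrE ?mulr_gt0 ?exprn_gt0 //.
    by rewrite ler_ln ?posrE ?mulr_gt0 ?exprn_gt0.
  move/le_trans; apply; rewrite !mulrDl addrC lerD //.
    by rewrite /f -tE -[L *+ _]mulr_natl mulrAC.
  rewrite /h [f n + _]addrC addrK addrC lerD ?lnS_over_n_le //.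
  rewrite -[ln _ *+ d]mulr_natl mulrAC ler_wpM2r ?ln_ge0 ?ler1n //; first lia.
  apply: (@le_trans _ _ ((q%:R + (n - q * (s n)./2)%:R) / n%:R)).
    by rewrite ler_pM2r ?invr_gt0 // -natrD ler_nat.
  rewrite mulrDl lerD //.
    rewrite ler_pM2l // /harmonic /= ler_pdivlMr // ?ltr0n // ler_pdivrMl //.
    by rewrite -natrM ler_nat; lia.
  have zE : z n * n%:R = n%:R - q%:R * ((s n)./2)%:R.
    rewrite mulrBl mul1r /u -[_ * n%:R]mulrA divfK ?gt_eqF //.
    rewrite -{1}(even_halfK sn_even) -mul2n natrM; lra.
  (* The truncated n - q(s/2) is n times the positive part of [z n]; the two signs are treated
     separately. *)
  rewrite ler_pdivrMr //; have [le|gt] := leqP (q * (s n)./2) n.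
    rewrite natrB // natrM -zE ler_pM2r //.
    by have := ler_norm (z n); lra.
  rewrite (_ : (n - _ = 0)%N); last by lia.
  by rewrite mulr_ge0 //; have := ler_norm (- z n); rewrite normrN; lra.
- by apply: cvgM; [apply: cvgB => //; exact: cvg_cst | exact: cvg_cst].
- rewrite -[X in _ --> X]addr0; apply: cvgD.
    by apply: cvgM; [apply: cvgB => //; exact: cvg_cst | exact: cvg_cst].
  have z_lim : z @ \oo --> 1 - q%:R / 2 * delta.
    by apply: cvgB; [exact: cvg_cst | apply: cvgM => //; exact: cvg_cst].
  (* This is where delta >= 2/q enters: the positive part of [z] tends to 0, so d is sublinear. *)
  have z_lim0 : 1 - q%:R / 2 * delta <= 0.
    rewrite subr_le0; move: qd; rewrite ler_pdivrMr //; lra.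
  rewrite -[X in _ --> X]addr0; apply: cvgD.
    rewrite -(mulr0 4); apply: cvgM; first exact: cvg_cst.
    rewrite -sqrtr0; apply: continuous_cvg; first exact: sqrt_continuous.
    exact: cvg_harmonic.
  rewrite -[X in _ --> X](mul0r (ln q%:R)); apply: cvgM; last exact: cvg_cst.
  rewrite -[X in _ --> X]addr0; apply: cvgD.
    rewrite -(mulr0 q%:R); apply: cvgM; first exact: cvg_cst.
    rewrite -(mulr0 2); apply: cvgM; first exact: cvg_cst.
    exact: cvg_harmonic.
  have -> : 0 = (1 - q%:R / 2 * delta + `|1 - q%:R / 2 * delta|) / 2 :> R.
    by rewrite ler0_norm // subrr mul0r.
  apply: cvgM; last exact: cvg_cst.
  by apply: cvgD => //; apply: cvg_norm.
Unshelve. all: by end_near.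
Qed.

Theorem theorem5 (R : realType) :
  (* (i) *)
  (forall q n s : nat, (3 <= q)%N -> (1 <= n)%N -> (s <= n - 1)%N -> ~~ odd s ->
     ((q * s <= 2 * (n - 1))%N ->
        forall b : nat, (b <= s./2)%N ->
          kappaA R q n (s - 2 * s./2) s./2 <= kappaA R q n (s - 2 * b) b) /\
     ((2 * (n - 1) <= q * s)%N ->
        let b0 := ((n - 1 - s) %/ (q - 2))%N in
        forall b : nat, (b <= s./2)%N ->
          kappaA R q n (s - 2 * b0) b0 <= kappaA R q n (s - 2 * b) b))
  /\
  (* (ii) *)
  (forall (q : nat) (delta : R) (s : nat -> nat),
     (3 <= q)%N -> 2 / q%:R <= delta -> delta <= 1 ->
     (forall n, ~~ odd (s n) /\ (s n <= n)%N) ->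
     (fun n : nat => (s n)%:R / n%:R : R) @ \oo --> delta ->
     (fun n : nat =>
        ln (\big[Order.min/kappaA R q n (s n) 0]_(b < (s n)./2.+1)
               kappaA R q n (s n - 2 * b) b) / n%:R : R)
       @ \oo --> (1 - delta) * ln (q%:R - 1)).
Proof.
split=> [q n s|q delta s q3 qd _ s_even sd]; first exact: kappaA_argmin.
exact: cvg_ln_min_kappaA.
Qed.
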